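(* Let $1\le d\le n$. The Catalan pellytope $\mathcal P_{d,n}$ is unimodularly equivalent to the hypergraphic polytope $\mathcal P_{\mathcal H_{d,n}}$ associated with the hypergraph $\mathcal H_{d,n}$.
   Context: For $1\le k\le n$ and $1\le j\le n-k+1$ let $q_{k,j}=1+y_j+y_jy_{j+1}+\cdots+y_jy_{j+1}\cdots y_{j+k-1}$. The Catalan pellytope is $\mathcal P_{d,n}=\operatorname{Newt}\bigl(\prod_{k=1}^{d}\prod_{j=1}^{n-k+1}q_{k,j}\bigr)=\sum_{k=1}^d\sum_{j=1}^{n-k+1}\operatorname{Newt}(q_{k,j})\subset\mathbb R^n$ (Minkowski sum of Newton polytopes). Let $\epsilon_0,\dots,\epsilon_n$ be the standard basis of $\mathbb Z^{n+1}$, and for $I\subseteq[0,n]=\{0,1,\dots,n\}$ let $\Delta_I=\operatorname{conv}(\epsilon_i:i\in I)$. For a hypergraph $\mathcal H$ with vertex set $[0,n]$ and set of hyperedges $\mathcal E$, the hypergraphic polytope is the Minkowski sum $\mathcal P_{\mathcal H}=\sum_{I\in\mathcal E}\Delta_I\subset\mathbb R^{n+1}$. $\mathcal H_{d,n}$ is the hypergraph with vertex set $[0,n]$ whose hyperedges are all intervals $I=\{a,a+1,\dots,b\}\subseteq[0,n]$ with $2\le|I|\le d+1$. Two lattice polytopes are unimodularly equivalent if, up to translation by a lattice vector, a lattice isomorphism sends one to the other; here the lattices are $\mathbb Z^n$ and $A_n=\{a\in\mathbb Z^{n+1}:\sum_{i=0}^n a_i=0\}$ (a translate of $\mathcal P_{\mathcal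 H_{d,n}}$ by a vector of $\mathbb Z^{n+1}$ lies in $A_n\otimes\mathbb R$). *)

(* Defs.v *)
From mathcomp Require Import all_boot all_order all_algebra.
From mathcomp Require Import boolp classical_sets functions reals convex.
From mathcomp Require Import mpoly.

Import Order.TTheory GRing.Theory Num.Theory.

Local Open Scope classical_set_scope.
Local Open Scope ring_scope.

Definition convex_hull {R : realType} {V : lmodType R} (A : set V) : set V :=
  smallest (@convex_set R V) A.

Definition minkowski_sum {R : realType} {V : lmodType R} {T : finType}
    (E : {set T}) (P : T -> set V) : set V :=
  [set x | exists2 p : T -> V,
     forall I, I \in E -> P I (p I) & x = \sum_(I in E) p I].

Definition translate {R : realType} {V : lmodType R} (v : V) (A : set V) :
  set V := [set v + x | x in A].

Definition exponent_vector (R : realType) {n : nat} (m : 'X_{1..n}) :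
  'rV[R]_n := \row_i (m i)%:R.

Definition Newt (R : realType) {n : nat} (p : {mpoly int[n]}) : set 'rV[R]_n :=
  convex_hull [set exponent_vector R m | m in [set` msupp p]].

(* The variable y_i (1 <= i <= n) is 'X_(i-1), the indices of {mpoly int[n]}
   being 0, ..., n-1; the inner product is y_j y_(j+1) ... y_(j+m-1). *)
Definition q_poly (n k j : nat) : {mpoly int[n]} :=
  \sum_(m < k.+1) \prod_(i < n | (j <= i.+1 < j + m)%N) 'X_i.

Definition catalan_pellytope (R : realType) (d n : nat) : set 'rV[R]_n :=
  Newt R (\prod_(1 <= k < d.+1) \prod_(1 <= j < (n - k + 1).+1) q_poly n k j).

Definition simplex (R : realType) {N : nat} (I : {set 'I_N}) : set 'rV[R]_N :=
  convex_hull [set delta_mx 0 i | i in [set` I]].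

(* A hypergraph with vertex set 'I_N is given by its set of hyperedges. *)
Definition hypergraphic_polytope (R : realType) {N : nat}
    (E : {set {set 'I_N}}) : set 'rV[R]_N := minkowski_sum E (simplex R).

Definition interval_hypergraph (d n : nat) : {set {set 'I_n.+1}} :=
  [set I : {set 'I_n.+1} |
     [exists a : 'I_n.+1, exists b : 'I_n.+1,
        I == [set i : 'I_n.+1 | (a <= i <= b)%N]]
     && (2 <= #|I| <= d.+1)%N]%SET.

Definition Zlattice (R : realType) (N : nat) : set 'rV[R]_N :=
  [set x | forall i, x 0 i \is a Num.int].

(* The real span of A_n. *)
Definition Ahyperplane (R : realType) (n : nat) : set 'rV[R]_n.+1 :=
  [set x | \sum_i x 0 i = 0].

Definition Alattice (R : realType) (n : nat) : set 'rV[R]_n.+1 :=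
  Zlattice R n.+1 `&` Ahyperplane R n.

(* An isomorphism of the lattices L and L' is given by its extension to a
   linear map of the ambient real vector spaces. *)
Definition unimodularly_equivalent {R : realType} {V V' : lmodType R}
    (L : set V) (L' : set V') (P : set V) (P' : set V') : Prop :=
  exists f : {linear V -> V'}, set_bij L L' f /\
    exists2 v, L' v & f @` P = translate v P'.

(* Main.v *)
Require Import Defs.
From HB Require Import structures.
From mathcomp Require Import all_boot all_order all_algebra.
From mathcomp Require Import classical_sets functions interval_inference reals.
From mathcomp Require Import convex.
From mathcomp Require Import mpoly zify.

(** Send the basis vector e_i of Z^n (0 <= i < n) to the simple root
    eps_(i+1) - eps_i of A_n; this is an isomorphism of lattices
    ([set_bij_root_mx]). The exponent vector of y_j ... y_(j+t-1) is a sum of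
    consecutive basis vectors, so its image telescopes to
    eps_(j-1+t) - eps_(j-1). As t runs over 0, ..., k, the Newton polytope of
    q_(k,j) therefore goes to the simplex on the interval [j-1, j-1+k],
    translated by - eps_(j-1) ([image_Newt_q_poly]).

    It remains to add these polytopes up. The polynomials q_(k,j) have
    nonnegative coefficients, so no cancellation occurs in their product: the
    support of the product is the Minkowski sum of the supports. Convex hulls
    and linear images commute with Minkowski sums, hence the image of the
    pellytope is the Minkowski sum of the translated simplices. Finally
    (k, j) |-> [j-1, j-1+k] is a bijection from the factors q_(k,j) to the
    hyperedges ([perm_interval_hypergraph]), and the translations collect into
    the single vector u = - sum_(k,j) eps_(j-1). With this choice of u the
    linear map carries the pellytope exactly onto the translated hypergraphic
    polytope, which therefore lies in the hyperplane of A_n because the range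
    of the map does.

    Minkowski addition is made into a commutative monoid law on sets, so that
    each of the steps above is a statement about iterated operators. *)

Import Order.TTheory GRing.Theory Num.Theory.

Local Open Scope classical_set_scope.
Local Open Scope ring_scope.

(** * Minkowski addition of sets *)

Section SetAdd.
Context {V : zmodType}.

Definition setadd (A B : set V) : set V := [set x + y | x in A & y in B].

Lemma setaddA : associative setadd.
Proof.
move=> A B C; apply/seteqP; split=> z /=.
- case=> x Ax [_ [y By [w Cw <-]] <-].
  exists (x + y); first by exists x => //; exists y.
  by exists w => //; rewrite addrA.
- case=> _ [x Ax [y By <-]] [w Cw <-].
  exists x => //; exists (y + w); last by rewrite addrA.
  by exists y => //; exists w.
Qed.

Lemma setaddC : commutative setadd.
Proof.
move=> A B; apply/seteqP; split=> z /= [x Ax [y By <-]];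
  by exists y => //; exists x => //; rewrite addrC.
Qed.

Lemma setadd0 : left_id [set 0] setadd.
Proof.
move=> A; apply/seteqP; split=> z /=.
  by case=> _ -> [y Ay <-]; rewrite add0r.
by move=> Az; exists 0 => //; exists z => //; rewrite add0r.
Qed.

HB.instance Definition _ :=
  Monoid.isComLaw.Build (set V) [set 0] setadd setaddA setaddC setadd0.

Lemma setadd11 (x y : V) : setadd [set x] [set y] = [set x + y].
Proof.
apply/seteqP; split=> z /=; first by case=> _ -> [_ -> <-].
by move=> ->; exists x => //; exists y.
Qed.

Lemma big_setadd1 (I : Type) (r : seq I) (F : I -> V) :
  \big[setadd/[set 0]]_(i <- r) [set F i] = [set \sum_(i <- r) F i].
Proof.
by apply/esym/(big_morph (fun x => [set x])) => // x y; rewrite setadd11.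
Qed.
End SetAdd.

Lemma setadd_translate {R : realType} {V : lmodType R} (v : V) (A : set V) :
  setadd [set v] A = translate v A.
Proof.
apply/seteqP; split=> z /=; first by case=> _ -> [y Ay <-]; exists y.
by case=> y Ay <-; exists v => //; exists y.
Qed.

(** A point of the left-hand side is given by a choice function on all of [T],
    one of the right-hand side by successive choices along an enumeration of
    [E]; the absence of repetitions in the enumeration is what allows the
    successive choices to be glued into one function. *)
Lemma minkowski_sumE {R : realType} {V : lmodType R} {T : finType}
    (E : {set T}) (P : T -> set V) :
  minkowski_sum E P = \big[setadd/[set 0]]_(I in E) P I.
Proof.
rewrite -big_enum /=; apply/seteqP; split=> x.
  case=> p Pp ->; rewrite -big_enum /=.
  have : {in enum E, forall I, P I (p I)}.
    by move=> I; rewrite mem_enum; exact: Pp.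
  elim: (enum E) => [|I s IHs] Ps; first by rewrite !big_nil.
  rewrite !big_cons; exists (p I); first by apply: Ps; rewrite mem_head.
  exists (\sum_(J <- s) p J) => //.
  by apply: IHs => J Js; apply: Ps; rewrite in_cons Js orbT.
move=> Ex; suff : exists2 p : T -> V, {in enum E, forall I, P I (p I)} &
    x = \sum_(I <- enum E) p I.
  case=> p Pp ->; exists p; last by rewrite big_enum.
  by move=> I IE; apply: Pp; rewrite mem_enum.
have := enum_uniq E.
elim: (enum E) x Ex => [|I s IHs] x /= + us.
  by rewrite !big_nil => ->; exists (fun=> 0); rewrite ?big_nil.
case/andP: us => Is us; rewrite big_cons => -[y Py [z /IHs[]// p Pp -> <-]].
exists (fun J => if J == I then y else p J).
  move=> J; rewrite in_cons; case: eqP => [->//|_] /=; exact: Pp.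
rewrite big_cons eqxx; congr (_ + _); apply: eq_big_seq => J Js.
by case: eqP Js Is => // -> ->.
Qed.

(** * Convex hulls *)

Section Hull.
Context {R : realType}.
Implicit Types V W : lmodType R.

Lemma convex_setE V (A : set V) :
  @convex_set R V A <->
  forall (t : {i01 R}) (x y : V), A x -> A y ->
    A (t%:num *: x + (1 - t%:num) *: y).
Proof.
split=> cA; first by move=> t x y /mem_set Ax /mem_set Ay; apply/set_mem/cA.
by move=> x y t /set_mem Ax /set_mem Ay; apply/mem_set/cA.
Qed.

Lemma convex_convex_hull V (A : set V) : @convex_set R V (convex_hull A).
Proof.
apply/convex_setE => t x y Ax Ay C [/[dup] cC /convex_setE + AC]; apply.
  by apply: Ax.
by apply: Ay.
Qed.

Lemma sub_convex_hull V (A : set V) : A `<=` convex_hull A.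
Proof. exact: sub_gen_smallest. Qed.

Lemma convex_hull_sub V (A B : set V) :
  @convex_set R V B -> A `<=` B -> convex_hull A `<=` B.
Proof. exact: smallest_sub. Qed.

Lemma convex_hull1 V (x : V) : convex_hull [set x] = [set x].
Proof.
apply: smallest_id; apply/convex_setE => t _ _ -> ->.
by rewrite -scalerDl addrC subrK scale1r.
Qed.

(** The translation by [v] is included so that the case of the identity map
    covers the translates used in [convex_hull_setadd]. *)
Lemma convex_preimage V W (f : {linear V -> W}) (v : W) (B : set W) :
  @convex_set R W B -> @convex_set R V [set x | B (v + f x)].
Proof.
move=> /convex_setE cB; apply/convex_setE => t x y /= Bx By.
rewrite linearD !linearZ /=.
have -> : v = t%:num *: v + (1 - t%:num) *: v.
  by rewrite -scalerDl addrC subrK scale1r.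
by rewrite addrACA -!scalerDr; exact: cB.
Qed.

Lemma convex_setadd V (A B : set V) :
  @convex_set R V A -> @convex_set R V B -> @convex_set R V (setadd A B).
Proof.
move=> /convex_setE cA /convex_setE cB; apply/convex_setE.
move=> t _ _ [x Ax [y By <-]] [x' Ax' [y' By' <-]].
exists (t%:num *: x + (1 - t%:num) *: x'); first exact: cA.
exists (t%:num *: y + (1 - t%:num) *: y'); first exact: cB.
by rewrite !scalerDr addrACA.
Qed.

(** For the inclusion from right to left, fix one summand and let the other
    vary: the points that a translation sends into the hull of the sum form a
    convex set. Applied with a fixed point of [A], this extends from [B] to
    its hull; applied again with a fixed point of the hull of [B], it extends
    from [A] to its hull. *)
Lemma convex_hull_setadd V (A B : set V) :
  convex_hull (setadd A B) = setadd (convex_hull A) (convex_hull B).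
Proof.
apply/seteqP; split.
  apply: convex_hull_sub.
    by apply: convex_setadd; exact: convex_convex_hull.
  move=> _ [x Ax [y By <-]].
  by exists x; [|exists y]; try exact: sub_convex_hull.
have cAB := convex_convex_hull _ (setadd A B).
have transl v : @convex_set R V [set w | convex_hull (setadd A B) (v + w)].
  exact: (convex_preimage _ _ idfun).
have addA x :
    A x -> convex_hull B `<=` [set y | convex_hull (setadd A B) (x + y)].
  move=> Ax; apply: convex_hull_sub => // y By.
  by apply: sub_convex_hull; exists x => //; exists y.
move=> _ [x Ax [y By <-]]; rewrite addrC.
apply: (convex_hull_sub _ _ [set w | convex_hull (setadd A B) (y + w)]
  _ _ x Ax) => //.
by move=> w Aw /=; rewrite addrC; exact: addA.
Qed.

Lemma image_convex_hull V W (f : {linear V -> W}) (A : set V) :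
  f @` convex_hull A = convex_hull (f @` A).
Proof.
apply/seteqP; split.
  move=> _ [x Ax <-]; rewrite -[f x]add0r; move: x Ax.
  apply: convex_hull_sub; first exact/convex_preimage/convex_convex_hull.
  by move=> x Ax; rewrite /= add0r; apply: sub_convex_hull; exists x.
apply: convex_hull_sub; last by apply: image_subset; exact: sub_convex_hull.
have /convex_setE cA := convex_convex_hull _ A.
apply/convex_setE => t _ _ [x Ax <-] [y Ay <-].
exists (t%:num *: x + (1 - t%:num) *: y); first exact: cA.
by rewrite linearD !linearZ.
Qed.

Lemma image_setadd V W (f : {linear V -> W}) (A B : set V) :
  f @` setadd A B = setadd (f @` A) (f @` B).
Proof.
apply/seteqP; split.
  move=> _ [_ [x Ax [y By <-]] <-]; rewrite linearD.
  by exists (f x); [exists x|exists (f y) => //; exists y].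
move=> _ [_ [x Ax <-] [_ [y By <-] <-]].
by exists (x + y); rewrite ?linearD //; exists x => //; exists y.
Qed.

Lemma image_big_setadd V W (f : {linear V -> W}) (I : Type) (r : seq I)
    (F : I -> set V) :
  f @` (\big[setadd/[set 0]]_(i <- r) F i) =
  \big[setadd/[set 0]]_(i <- r) (f @` F i).
Proof.
apply: (big_morph (image^~ f)); first exact: image_setadd.
by rewrite image_set1 linear0.
Qed.
End Hull.

(** * Newton polytopes of products *)

Section Newton.
Context (R : realType) {n : nat}.
Implicit Types p q : {mpoly int[n]}.

Definition exponents p : set 'rV[R]_n :=
  [set exponent_vector R m | m in [set` msupp p]].

Definition coef_ge0 p := forall m, 0 <= p@_m.

Lemma exponent_vectorD (m1 m2 : 'X_{1..n}) :
  exponent_vector R (m1 + m2)%MM = exponent_vector R m1 + exponent_vector R m2.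
Proof. by apply/rowP=> i; rewrite !mxE mnmDE natrD. Qed.

Lemma coef_ge0M p q : coef_ge0 p -> coef_ge0 q -> coef_ge0 (p * q).
Proof.
by move=> p0 q0 m; rewrite mcoeffM; apply: sumr_ge0 => k _; rewrite mulr_ge0.
Qed.

(** The support of a product lies in the sum of the supports for any two
    polynomials. The converse needs the signs: without cancellation, the
    coefficient of the product at [m1 + m2] is at least the product of the
    coefficients at [m1] and [m2]. *)
Lemma exponentsM p q : coef_ge0 p -> coef_ge0 q ->
  exponents (p * q) = setadd (exponents p) (exponents q).
Proof.
move=> p0 q0; apply/seteqP; split=> x.
  case=> m /= /msuppM_le /allpairsP[[m1 m2] /= [m1p m2q ->]] <-.
  by rewrite exponent_vectorD; exists (exponent_vector R m1); [exists m1|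
    exists (exponent_vector R m2) => //; exists m2].
case=> _ [m1 /= m1p <-] [_ [m2 /= m2q <-] <-].
exists (m1 + m2)%MM; last exact: exponent_vectorD.
have lt1 : (mdeg m1 < (mdeg (m1 + m2)%MM).+1)%N by rewrite mdegD ltnS leq_addr.
have lt2 : (mdeg m2 < (mdeg (m1 + m2)%MM).+1)%N by rewrite mdegD ltnS leq_addl.
rewrite /= mcoeff_msupp mcoeffM.
(* (m1, m2) indexes one term of this sum of nonnegative terms. *)
rewrite (bigD1 (BMultinom lt1, BMultinom lt2)) //= gt_eqF //.
rewrite ltr_wpDr ?sumr_ge0 // => [k _|]; first by rewrite mulr_ge0.
by rewrite mulr_gt0 // lt_neqAle eq_sym -mcoeff_msupp ?p0 ?q0 ?m1p ?m2q.
Qed.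

Lemma Newt_prod (I : Type) (r : seq I) (F : I -> {mpoly int[n]}) :
  (forall i, coef_ge0 (F i)) ->
  Newt R (\prod_(i <- r) F i) = \big[setadd/[set 0]]_(i <- r) Newt R (F i).
Proof.
move=> F0.
suff [] : coef_ge0 (\prod_(i <- r) F i) /\
    Newt R (\prod_(i <- r) F i) = \big[setadd/[set 0]]_(i <- r) Newt R (F i).
  by [].
apply: (big_ind2 (fun p A => coef_ge0 p /\ Newt R p = A)) => [|p A q B|//].
- split=> [m|]; first by rewrite mcoeff1.
  rewrite -[RHS]convex_hull1; congr convex_hull; rewrite msupp1.
  have e0 : exponent_vector R (0%MM : 'X_{1..n}) = 0.
    by apply/rowP=> i; rewrite !mxE mnm0E.
  apply/seteqP; split=> x /=.
    by case=> m; rewrite inE => /eqP-> <-.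
  by move=> ->; exists 0%MM; rewrite ?inE.
- move=> [p0 <-] [q0 <-]; split; first exact: coef_ge0M.
  by rewrite /Newt -convex_hull_setadd -exponentsM.
Qed.
End Newton.

(** * Intervals and the hyperedges *)

Section Hypergraph.
Context (n : nat).

Definition interval_set (a b : nat) : {set 'I_n.+1} :=
  [set i : 'I_n.+1 | (a <= i <= b)%N]%SET.

Lemma card_interval_set a b : (b <= n)%N -> #|interval_set a b| = (b.+1 - a)%N.
Proof.
move=> bn; rewrite -sum1_card -[RHS]muln1 -sum_nat_const_nat big_geq_mkord.
rewrite (big_ord_widen_cond _ _ (fun=> 1%N) (bn : (b.+1 <= n.+1)%N)).
by apply: eq_bigl => i; rewrite inE.
Qed.

Lemma interval_set_inj a b a' b' : (a <= b <= n)%N -> (a' <= b' <= n)%N ->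
  interval_set a b = interval_set a' b' -> (a = a') /\ (b = b').
Proof.
move=> abn abn' /setP eqI.
have := eqI (inord a); have := eqI (inord b).
have := eqI (inord a'); have := eqI (inord b').
rewrite !inE !inordK; lia.
Qed.

(** The indices of the factors of the Catalan pellytope, in the order of the
    iterated product that defines it. *)
Definition catalan_pairs (d : nat) : seq (nat * nat) :=
  [seq (k, j) | k <- index_iota 1 d.+1, j <- index_iota 1 (n - k + 1).+1].

Lemma mem_catalan_pairs d x : (d <= n)%N ->
  (x \in catalan_pairs d) = [&& 0 < x.1 <= d, 0 < x.2 & x.2.-1 + x.1 <= n]%N.
Proof.
case: x => k j dn /=; apply/allpairsPdep/idP => /=.
  by case=> k' [j' []]; rewrite !mem_index_iota => ? ? [-> ->]; lia.
by move=> kj; exists k, j; rewrite !mem_index_iota; split=> //; lia.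
Qed.

Lemma uniq_catalan_pairs d : uniq (catalan_pairs d).
Proof.
apply: allpairs_uniq_dep => [|k _|]; rewrite ?iota_uniq //.
by move=> [k j] [k' j'] _ _ /= [-> ->].
Qed.

(** The interval [a, b] comes from the factor with k = b - a and j = a + 1, so
    the bound 2 <= b - a + 1 <= d + 1 on its cardinal says 1 <= k <= d, and
    b <= n says j <= n - k + 1. *)
Lemma perm_interval_hypergraph d : (d <= n)%N ->
  perm_eq (enum (interval_hypergraph d n))
    [seq interval_set x.2.-1 (x.2.-1 + x.1) | x <- catalan_pairs d].
Proof.
move=> dn; apply: uniq_perm; first exact: enum_uniq.
  rewrite map_inj_in_uniq ?uniq_catalan_pairs // => -[k j] [k' j'].
  rewrite !mem_catalan_pairs //= => kj kj' /interval_set_inj[]; try lia.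
  by move=> ? ?; congr pair; lia.
move=> I; rewrite mem_enum inE; apply/andP/mapP => /=.
  case=> /existsP[a /existsP[b /eqP ->]].
  rewrite card_interval_set -1?ltnS // => ab.
  exists ((b - a)%N, a.+1).
    by rewrite mem_catalan_pairs //=; have := ltn_ord b; lia.
  by rewrite /= subnKC //; lia.
case=> -[k j]; rewrite mem_catalan_pairs //= => kj ->.
rewrite card_interval_set; last lia.
split; last lia.
apply/existsP; exists (inord j.-1); apply/existsP; exists (inord (j.-1 + k)).
by apply/eqP/setP => i; rewrite !inE !inordK //; lia.
Qed.
End Hypergraph.

(** * The lattice isomorphism *)

Section Roots.
Context (R : realType) (n : nat).

(** The index is a natural number so that sums over consecutive indices
    telescope; only values up to [n] are meaningful. *)
Definition epsilon (t : nat) : 'rV[R]_n.+1 := delta_mx 0 (inord t).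

Definition interval_vec (a b : nat) : 'rV[R]_n := \row_i (a <= i < b)%N%:R.

(** The rows are the simple roots of A_n; acting on row vectors from the right,
    this matrix gives the lattice isomorphism. *)
Definition root_mx : 'M[R]_(n, n.+1) :=
  \matrix_(i < n) (epsilon i.+1 - epsilon i).

Lemma interval_vec_root a b : (a <= b <= n)%N ->
  interval_vec a b *m root_mx = epsilon b - epsilon a.
Proof.
case/andP=> ab bn; rewrite mulmx_sum_row -(telescope_sumr _ ab).
rewrite big_geq_mkord.
rewrite (big_ord_widen_cond _ _ (fun i => epsilon i.+1 - epsilon i) bn).
rewrite big_mkcond /= [RHS]big_mkcond /=; apply: eq_bigr => i _.
by rewrite mxE rowK; case: ifP; rewrite ?scale1r ?scale0r.
Qed.

Lemma root_mx_inj : injective (mulmxr root_mx : 'rV[R]_n -> 'rV[R]_n.+1).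
Proof.
(* A right inverse: the image of row t is eps_t - eps_n by telescoping, which is
   eps_t modulo eps_n. *)
pose N : 'M[R]_(n.+1, n) := \matrix_(t < n.+1) - interval_vec t n.
have MN : root_mx *m N = 1%:M.
  apply/row_matrixP=> i; rewrite row_mul rowK mulmxBl -!rowE !rowK opprK.
  apply/rowP=> l; have ilt : (i < n.+1)%N by rewrite ltnW // ltnS.
  rewrite !mxE !inordK ?ltnS // ltn_ord !andbT.
  have -> : (i == l) = (i <= l)%N && ~~ (i < l)%N by rewrite -leqNgt -eqn_leq.
  by case: (ltnP i l) => [/ltnW ->|_]; rewrite ?addNr ?oppr0 ?add0r ?andbT.
by apply: (can_inj (g := mulmxr N)) => x /=; rewrite -mulmxA MN mulmx1.
Qed.

Lemma root_mx_sum (x : 'rV[R]_n) : \sum_i (x *m root_mx) 0 i = 0.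
Proof.
under eq_bigr do rewrite mxE.
rewrite exchange_big big1 //= => l _; rewrite -mulr_sumr.
have sum_epsilon t : \sum_i epsilon t 0 i = 1.
  rewrite (bigD1 (inord t)) //= mxE !eqxx big1 ?addr0 // => i /negPf it.
  by rewrite mxE it andbF.
rewrite (eq_bigr (fun i => epsilon l.+1 0 i - epsilon l 0 i)) => [|i _].
  by rewrite sumrB !sum_epsilon subrr mulr0.
by rewrite !mxE.
Qed.

Lemma set_bij_root_mx :
  set_bij (Zlattice R n) (Alattice R n) (mulmxr root_mx).
Proof.
split.
- move=> x Zx; split; last exact: root_mx_sum.
  move=> i; rewrite mxE; apply: rpred_sum => l _; rewrite rpredM //.
  by rewrite !mxE rpredB ?rpred_nat.
- by move=> x y _ _; exact: root_mx_inj.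
- move=> y [Zy Hy].
  (* The image of this vector is y - (sum_t y_t) eps_n, and y has sum zero. *)
  exists (- \sum_t y 0 t *: interval_vec t n).
    move=> i; rewrite mxE summxE rpredN rpred_sum // => t _.
    by rewrite !mxE rpredM ?rpred_nat.
  rewrite /= mulNmx mulmx_suml -sumrN [RHS]row_sum_delta.
  transitivity (\sum_t (y 0 t *: epsilon t - y 0 t *: epsilon n)).
    apply: eq_bigr => t _; rewrite -scalemxAl interval_vec_root.
      by rewrite -scalerN opprB scalerBr.
    by rewrite -ltnS ltn_ord leqnn.
  rewrite sumrB -scaler_suml Hy scale0r subr0.
  by apply: eq_bigr => t _; rewrite /epsilon inord_val.
Qed.

(** The monomials of [q_poly n k j] are the products of y_j, ..., y_(j+t-1) for
    t <= k; their images are eps_(j-1+t) - eps_(j-1), where j-1+t runs over the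
    interval from j-1 to j-1+k. *)
Lemma image_Newt_q_poly k j : (0 < j)%N -> (j.-1 + k <= n)%N ->
  mulmxr root_mx @` Newt R (q_poly n k j) =
  setadd [set - epsilon j.-1] (simplex R (interval_set n j.-1 (j.-1 + k))).
Proof.
move=> j0 jkn; rewrite image_convex_hull -(convex_hull1 _ (- epsilon j.-1)).
rewrite -convex_hull_setadd; congr convex_hull.
pose mon t : 'X_{1..n} := (\sum_(i < n | (j <= i.+1 < j + t)%N) U_(i))%MM.
have exp_mon t : exponent_vector R (mon t) = interval_vec j.-1 (j.-1 + t).
  apply/rowP=> i; rewrite !mxE mnm_sumE; congr (_%:R).
  under eq_bigr do rewrite mnm1E.
  rewrite big_mkcond (bigD1 i) //= big1 => [|l /negPf ->]; last by case: ifP.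
  by rewrite eqxx addn0; case: ifP => /= H; apply/esym; lia.
have supp m : (m \in msupp (q_poly n k j)) = [exists t : 'I_k.+1, m == mon t].
  rewrite mcoeff_msupp /q_poly raddf_sum /=.
  under eq_bigr do rewrite mprodXE mcoeffX.
  rewrite psumr_neq0 //; apply/hasP/existsP => [[t _ /=]|[t]].
    by case: eqP => [<-|]; rewrite ?ltxx //; exists t.
  by move/eqP->; exists t; rewrite ?mem_index_enum //= eqxx.
apply/seteqP; split=> x /=.
- case=> _ [m /= + <-] <-; rewrite supp => /existsP[t /eqP ->].
  exists (- epsilon j.-1) => //; exists (epsilon (j.-1 + t)).
    exists (inord (j.-1 + t)) => //=.
    by rewrite inE inordK; have := ltn_ord t; lia.
  rewrite /= exp_mon interval_vec_root; first exact: addrC.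
  by have := ltn_ord t; lia.
- case=> _ -> [_ [i /= + <-] <-]; rewrite inE => /andP[ji ijk].
  exists (interval_vec j.-1 i).
    have ik : (i - j.-1 < k.+1)%N by lia.
    exists (mon (i - j.-1)%N); last by rewrite exp_mon subnKC.
    by rewrite /= supp; apply/existsP; exists (Ordinal ik).
  rewrite /= interval_vec_root; last by rewrite ji -ltnS ltn_ord.
  by rewrite {1}/epsilon inord_val; exact: addrC.
Qed.
End Roots.

(** * The equivalence *)

Lemma coef_ge0_q_poly n k j : @coef_ge0 n (q_poly n k j).
Proof.
move=> m; rewrite raddf_sum sumr_ge0 // => t _.
by rewrite /= mprodXE mcoeffX.
Qed.

Theorem proposition3p5 (R : realType) (d n : nat) (hd : (1 <= d <= n)%N) :
  exists2 u : 'rV[R]_n.+1,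
    Zlattice R n.+1 u /\
    translate u (hypergraphic_polytope R (interval_hypergraph d n))
      `<=` Ahyperplane R n &
    unimodularly_equivalent (Zlattice R n) (Alattice R n)
      (catalan_pellytope R d n)
      (translate u (hypergraphic_polytope R (interval_hypergraph d n))).
Proof.
have dn : (d <= n)%N by case/andP: hd.
(* Each factor contributes the translation by - eps_(j-1). *)
pose u : 'rV[R]_n.+1 := \sum_(x <- catalan_pairs n d) - epsilon R n x.2.-1.
have fP : mulmxr (root_mx R n) @` catalan_pellytope R d n =
    translate u (hypergraphic_polytope R (interval_hypergraph d n)).
  rewrite /catalan_pellytope -(big_allpairs_dep (I2 := fun=> nat)
    (h := fun k j : nat => (k, j)) (F := fun x => q_poly n x.1 x.2)).
  rewrite -/(catalan_pairs n d).
  rewrite Newt_prod => [|x]; last exact: coef_ge0_q_poly.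
  rewrite image_big_setadd.
  rewrite -setadd_translate /hypergraphic_polytope minkowski_sumE -big_enum.
  rewrite (perm_big _ (perm_interval_hypergraph _ _ dn)) big_map.
  rewrite -big_setadd1 -big_split /=.
  rewrite big_seq [RHS]big_seq; apply: eq_bigr => x.
  rewrite mem_catalan_pairs // => /and3P[? ? ?].
  exact: image_Newt_q_poly.
exists u; first split.
- move=> i; rewrite summxE rpred_sum // => x _.
  by rewrite !mxE rpredN rpred_nat.
- by rewrite -fP => _ [x _ <-]; exact: root_mx_sum.
exists (mulmxr (root_mx R n)); split; first exact: set_bij_root_mx.
exists 0.
  by split=> [i|]; rewrite /Ahyperplane /= ?big1 ?mxE // => i; rewrite mxE.
by rewrite fP -[RHS]setadd_translate setadd0.
Qed.
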